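(* In the Gaussian shared-control model described in the context, for every arm $i$ the process $(M_{i,t})_{t\ge0}$ defined, for a fixed $\lambda_i>0$, by $$M_{i,t}=\prod_{u=a_i}^{t}\exp\Big(\lambda_iZ_{i,u}-\frac{\lambda_i^2}{2}\Big)\quad(t\ge a_i),\qquad M_{i,t}=1\quad(t<a_i),\qquad Z_{i,u}=\frac{X_{i,u}-C_u}{\sqrt2},$$ is a nonnegative test supermartingale for $H_i=\{\mu_i\le0\}$ relative to the global filtration $(\mathcal F_t)_{t\ge0}$ generated by all control outcomes, all active-arm outcomes, and all past decisions. Hence it is a global $e$-process: $\mathbb E_P[M_{i,\tau}]\le1$ for every $P\in H_i$ and every $(\mathcal F_t)$-stopping time $\tau$ with $P(\tau<\infty)=1$. The coordinate processes may be strongly dependent across arms.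
   Context: Model. Time is discrete, $t\in\{0,1,2,\dots\}$. Treatment arms $i$ have deterministic activation times $a_i$, and arm $i$ is active at time $t$ if $a_i\le t$. At global update $t$ a fresh control outcome $C_t\sim N(0,1)$ is observed and, for every active arm $i$ (that is, $a_i\le t$), an outcome $X_{i,t}\sim N(\mu_i,1)$. Conditional on $\mathcal F_{t-1}$, the control outcome $C_t$ and the active-arm outcomes are mutually independent with the stated Gaussian laws; all active comparisons use the same $C_t$. Thus $Z_{i,t}\sim N(\mu_i/\sqrt2,1)$, and $\operatorname{Corr}(Z_{i,t},Z_{j,t})=1/2$ for distinct active arms $i,j$ because the control is shared. Here $(\mathcal F_t)$ is the global filtration generated by all control outcomes, all active-arm outcomes, and all past decisions. The one-sided null $H_i$ is the set of model distributions with $\mu_i\le0$. A test supermartingale for $H$ is a nonnegative adapted process that is a supermartingale under every $P\in H$ and has initial value at most one.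
   Formalization: For an arm active from time 0 (a_i = 0), M_{i,0} already contains a Gaussian factor and can exceed one, so ''initial value at most one'' is stated pointwise only for a_i > 0 and as E_P[M_{i,0}] ≤ 1 for every P in H_i when a_i = 0. *)

(* Defs.v *)
From HB Require Import structures.
From mathcomp Require Export all_boot all_order all_algebra.
From mathcomp Require Export all_classical all_reals all_analysis.

Set Implicit Arguments.
Unset Strict Implicit.
Unset Printing Implicit Defensive.

Import Order.TTheory GRing.Theory Num.Theory.
Import numFieldNormedType.Exports.

Local Open Scope classical_set_scope.
Local Open Scope ring_scope.

(* Sub-sigma-algebras are represented as set systems [G : set (set T)], and a
   filtration as a sequence of such systems. *)

Definition measurable_wrt d (T : measurableType d) (R : realType)
    (G : set (set T)) (f : T -> R) : Prop :=
  forall B : set R, measurable B -> G (f @^-1` B).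

(* [Y] is a version of the conditional expectation E_P[X | G]. *)
Definition is_cond_expectation d (T : measurableType d) (R : realType)
    (P : probability T R) (G : set (set T)) (X Y : T -> R) : Prop :=
  [/\ measurable_wrt G Y,
      P.-integrable setT (EFin \o Y) &
      forall A, G A ->
        (\int[P]_(w in A) (Y w)%:E = \int[P]_(w in A) (X w)%:E)%E].

(* [Y] is a version of the conditional probability P(E | G). *)
Definition is_cond_probability d (T : measurableType d) (R : realType)
    (P : probability T R) (G : set (set T)) (E : set T) (Y : T -> R) : Prop :=
  is_cond_expectation P G (\1_E) Y.

Definition adapted d (T : measurableType d) (R : realType)
    (F : nat -> set (set T)) (M : nat -> T -> R) : Prop :=
  forall t, measurable_wrt (F t) (M t).

Definition supermartingale d (T : measurableType d) (R : realType)
    (P : probability T R) (F : nat -> set (set T)) (M : nat -> T -> R) : Prop :=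
  [/\ adapted F M,
      forall t, P.-integrable setT (EFin \o M t) &
      forall t, exists2 Y : T -> R,
        is_cond_expectation P (F t) (M t.+1) Y &
        {ae P, forall w, Y w <= M t w}].

Definition test_supermartingale d (T : measurableType d) (R : realType)
    (F : nat -> set (set T)) (H : set (probability T R))
    (M : nat -> T -> R) : Prop :=
  [/\ forall t w, 0 <= M t w,
      adapted F M,
      forall P, H P -> supermartingale P F M &
      forall w, M 0%N w <= 1].

(* As [test_supermartingale], with the bound on the initial value required
   only in expectation: if arm i is active from time 0, the process of
   interest already contains the factor of time 0 at t = 0, and its initial
   value in the pointwise sense is the empty product at "t = -1". *)
Definition mean_test_supermartingale d (T : measurableType d) (R : realType)
    (F : nat -> set (set T)) (H : set (probability T R))
    (M : nat -> T -> R) : Prop :=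
  [/\ forall t w, 0 <= M t w,
      adapted F M,
      forall P, H P -> supermartingale P F M &
      forall P, H P -> ('E_P[M 0%N] <= 1)%E].

(* [None] stands for the value +oo. *)
Definition stopping_time d (T : measurableType d)
    (F : nat -> set (set T)) (tau : T -> option nat) : Prop :=
  forall t, F t [set w | exists2 s, tau w = Some s & (s <= t)%N].

(* The value 0 on {tau = +oo} is a convention; it is only used for almost
   surely finite stopping times. *)
Definition stopped d (T : measurableType d) (R : realType)
    (M : nat -> T -> R) (tau : T -> option nat) (w : T) : R :=
  if tau w is Some t then M t w else 0.

Definition e_process d (T : measurableType d) (R : realType)
    (F : nat -> set (set T)) (H : set (probability T R))
    (M : nat -> T -> R) : Prop :=
  [/\ forall t w, 0 <= M t w,
      adapted F M &
      forall P tau, H P -> stopping_time F tau ->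
        P [set w | tau w != None] = 1%E ->
        ('E_P[stopped M tau] <= 1)%E].

Definition independent_rv d (T : measurableType d) (R : realType)
    (P : probability T R) (U V : T -> R) : Prop :=
  forall A B : set R, measurable A -> measurable B ->
    P (U @^-1` A `&` V @^-1` B) = (P (U @^-1` A) * P (V @^-1` B))%E.

(* The information carried by the updates s < n: the controls, the outcomes of
   the arms active at s, and the decisions [D s] taken after update s.  For
   n = 0 it is the trivial sigma-algebra, playing the role of F_{-1}.
   The values [X i s] with s < a i are meaningless and never used. *)
Definition history d (T : measurableType d) (R : realType)
    d' (S : measurableType d') (I : choiceType) (a : I -> nat)
    (C : nat -> {mfun T >-> R}) (X : I -> nat -> {mfun T >-> R})
    (D : nat -> {mfun T >-> S}) (n : nat) : set (set T) :=
  <<s [set E | exists2 s, (s < n)%N &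
        [\/ preimage_set_system setT (C s) measurable E,
            exists2 i, (a i <= s)%N &
              preimage_set_system setT (X i s) measurable E |
            preimage_set_system setT (D s) measurable E]] >>.

Definition global_filtration d (T : measurableType d) (R : realType)
    d' (S : measurableType d') (I : choiceType) (a : I -> nat)
    (C : nat -> {mfun T >-> R}) (X : I -> nat -> {mfun T >-> R})
    (D : nat -> {mfun T >-> S}) (t : nat) : set (set T) :=
  history a C X D t.+1.

(* [P] is a model distribution with arm means [mu]: given F_{t-1}, the control
   and any finitely many distinct active arms have the product of the Gaussian
   laws N(0,1) and N(mu_i,1) as joint conditional law. *)
Definition shared_control_model d (T : measurableType d) (R : realType)
    d' (S : measurableType d') (I : choiceType) (a : I -> nat)
    (C : nat -> {mfun T >-> R}) (X : I -> nat -> {mfun T >-> R})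
    (D : nat -> {mfun T >-> S}) (mu : I -> R) (P : probability T R) : Prop :=
  forall (t : nat) (J : seq I) (A : set R) (B : I -> set R),
    uniq J -> (forall i, i \in J -> (a i <= t)%N) ->
    measurable A -> (forall i, measurable (B i)) ->
    is_cond_probability P (history a C X D t)
      (C t @^-1` A `&` [set w | forall i, i \in J -> B i (X i t w)])
      (cst (fine (normal_prob 0 1 A) *
            \prod_(i <- J) fine (normal_prob (mu i) 1 (B i)))).

Definition null_hypothesis d (T : measurableType d) (R : realType)
    d' (S : measurableType d') (I : choiceType) (a : I -> nat)
    (C : nat -> {mfun T >-> R}) (X : I -> nat -> {mfun T >-> R})
    (D : nat -> {mfun T >-> S}) (i : I) : set (probability T R) :=
  [set P | exists2 mu : I -> R,
             shared_control_model a C X D mu P & mu i <= 0].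

Definition comparison d (T : measurableType d) (R : realType) (I : choiceType)
    (C : nat -> {mfun T >-> R}) (X : I -> nat -> {mfun T >-> R})
    (i : I) (u : nat) (w : T) : R :=
  (X i u w - C u w) / Num.sqrt 2.

Definition arm_process d (T : measurableType d) (R : realType)
    (I : choiceType) (a : I -> nat)
    (C : nat -> {mfun T >-> R}) (X : I -> nat -> {mfun T >-> R})
    (lambda : I -> R) (i : I) (t : nat) (w : T) : R :=
  if (a i <= t)%N then
    \prod_(a i <= u < t.+1)
      expR (lambda i * comparison C X i u w - lambda i ^+ 2 / 2)
  else 1.

(* Main.v *)
Require Import Defs.
From mathcomp Require Import measurable_realfun ring.

Set Implicit Arguments.
Unset Strict Implicit.
Unset Printing Implicit Defensive.

Import Order.TTheory GRing.Theory Num.Theory.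
Import numFieldNormedType.Exports.

Local Open Scope classical_set_scope.
Local Open Scope ring_scope.

(** Why the result holds.  Write the process of a set J of arms at time t as the
    product over i in J of the arm processes.  One update multiplies it by
    exp(sum_i (lambda_i Z_i - lambda_i^2/2)), the sum running over the active
    arms of J, and sum_i lambda_i Z_i is a linear combination of the independent
    Gaussian variables C_t and X_{i,t}, independent of the past.  The Gaussian
    moment generating function therefore shows that the factor has conditional
    mean exp(g), where

      g = sum_i lambda_i mu_i / sqrt 2 + sum_{i<j} lambda_i lambda_j / 2.

    For a single arm the second sum is empty, so g <= 0 under the null: this is
    the supermartingale property, and the mean is at most one from the first
    update on.  The e-process property is then optional stopping for nonnegative
    supermartingales.  For two active arms, the term
    lambda_i lambda_j / 2 > 0, due to the shared control, makes the mean of the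
    product strictly larger than the product of the means; hence the covariance
    is positive and the two processes are not independent.

    The model only speaks of the conditional probabilities of rectangles.  The
    passage from events to exponentials goes through [weighted_integral_comp]:
    if integrating a weight Phi over the events {V in B} gives c nu(B), then
    integrating Phi g(V) gives c times the nu-integral of g.  It replaces one
    indicator at a time by a function, which avoids joint laws on product
    spaces; [weighted_integral_prod] iterates it over the control and the arms,
    and a last application, with V a function of the past, brings in the
    past.  The same lemma yields the moment generating function (V the identity
    and Phi the density) and the product rule for independent variables. *)

(** * From weights on events to weights on functions *)

Import HBNNSimple.

Lemma weighted_integral_simple d d' (T : measurableType d) (U : measurableType d')
    (R : realType) (m : {measure set T -> \bar R}) (nu : {measure set U -> \bar R})
    (Phi : T -> R) (V : T -> U) (c : R) (h : {nnsfun U >-> R}) :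
  measurable_fun setT Phi -> (forall x, 0 <= Phi x) ->
  measurable_fun setT V ->
  (forall B, measurable B ->
    (\int[m]_x (Phi x * \1_B (V x))%:E = c%:E * nu B)%E) ->
  0 <= c ->
  (\int[m]_x (Phi x * h (V x))%:E = c%:E * \int[nu]_y (h y)%:E)%E.
Proof.
move=> mPhi Phi0 mV PhiV c0.
pose I1 r x := (r * (Phi x * \1_(h @^-1` [set r]) (V x)))%:E.
have mB r : measurable (h @^-1` [set r]) by exact: measurable_sfunP.
have mI r : measurable_fun setT (fun x => Phi x * \1_(h @^-1` [set r]) (V x)).
  by apply: measurable_funM => //; exact: measurableT_comp.
under eq_integral => x _.
  rewrite (_ : _%:E = (\sum_(r \in range h) I1 r x)%E); last first.
    rewrite fsumEFin// fimfunE mulr_fsumr; congr EFin.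
    by apply: eq_fsbigr => r _; rewrite mulrCA.
  over.
rewrite /= (@ge0_integral_fsum _ _ _ m); last 4 first.
- by [].
- by move=> r; apply/measurable_EFinP/measurable_funM.
- move=> r x _; rewrite lee_fin /I1.
  have := nnfun_muleindic_ge0 h r (V x); rewrite lee_fin => h0.
  by rewrite mulrCA mulr_ge0.
- exact: fimfunP.
rewrite integralT_nnsfun sintegralE.
rewrite ge0_mule_fsumr; last by move=> r; exact: nnsfun_mulemu_ge0.
apply: eq_fsbigr => r; rewrite inE => -[y _ <-].
under eq_integral do rewrite /I1 EFinM.
rewrite ge0_integralZl//=; first by rewrite PhiV// muleCA.
- exact/measurable_EFinP.
- by move=> x _; rewrite lee_fin mulr_ge0.
- by rewrite lee_fin.
Qed.

(** Both sides are continuous along an increasing sequence of simple functions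
    converging to [g], so the case of simple functions suffices. *)
Lemma weighted_integral_comp d d' (T : measurableType d) (U : measurableType d')
    (R : realType) (m : {measure set T -> \bar R}) (nu : {measure set U -> \bar R})
    (Phi : T -> R) (V : T -> U) (c : R) (g : U -> R) :
  measurable_fun setT Phi -> (forall x, 0 <= Phi x) ->
  measurable_fun setT V ->
  (forall B, measurable B ->
    (\int[m]_x (Phi x * \1_B (V x))%:E = c%:E * nu B)%E) ->
  0 <= c ->
  measurable_fun setT g -> (forall y, 0 <= g y) ->
  (\int[m]_x (Phi x * g (V x))%:E = c%:E * \int[nu]_y (g y)%:E)%E.
Proof.
move=> mPhi Phi0 mV PhiV c0 /measurable_EFinP mg g0.
pose h := nnsfun_approx measurableT mg.
have hg y : EFin (h n y) @[n --> \oo] --> (g y)%:E.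
  by apply: cvg_nnsfun_approx => // z _; rewrite lee_fin.
have hnd y : {homo h^~ y : n k / (n <= k)%N >-> n <= k}.
  by move=> n k nk; exact/lefP/nd_nnsfun_approx.
have cvgr : (\int[nu]_y (h n y)%:E)%E @[n --> \oo] --> (\int[nu]_y (g y)%:E)%E.
  rewrite (eq_integral (fun y => limn (fun n => (h n y)%:E))); last first.
    by move=> y _; apply/esym/cvg_lim => //; exact: hg.
  apply: cvg_monotone_convergence => //.
  - by move=> n; apply/measurable_EFinP.
  - by move=> n y _; rewrite lee_fin.
  - by move=> y _ n k nk; rewrite lee_fin hnd.
have cvgl : (\int[m]_x (Phi x * h n (V x))%:E)%E @[n --> \oo] -->
    (\int[m]_x (Phi x * g (V x))%:E)%E.
  rewrite (eq_integral (fun x => limn (fun n => (Phi x * h n (V x))%:E))); last first.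
    move=> x _; apply/esym/cvg_lim => //; rewrite EFinM.
    by under eq_fun do rewrite EFinM; apply: cvgeZl => //; exact: hg.
  apply: cvg_monotone_convergence => //.
  - move=> n; apply/measurable_EFinP/measurable_funM => //.
    exact: measurableT_comp.
  - by move=> n y _; rewrite lee_fin mulr_ge0.
  - by move=> y _ n k nk; rewrite lee_fin ler_wpM2l// hnd.
apply: (cvg_unique _ cvgl) => //.
have simple n := weighted_integral_simple (h n) mPhi Phi0 mV PhiV c0.
by rewrite (funext simple); exact: cvgeZl.
Qed.

Lemma integral_mul_indic d (T : measurableType d) (R : realType)
    (m : {measure set T -> \bar R}) (A : set T) (f : T -> R) :
  (\int[m]_x (f x * \1_A x)%:E = \int[m]_(x in A) (f x)%:E)%E.
Proof.
by rewrite [RHS]integral_mkcond epatch_indic; apply: eq_integral => x _; rewrite EFinM.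
Qed.

(** The case where [nu] is the law of [V]. *)
Lemma weighted_integral_pushforward d (T : measurableType d) (R : realType)
    (m : {measure set T -> \bar R}) (Phi V : T -> R) (c : R) :
  measurable_fun setT Phi -> (forall x, 0 <= Phi x) ->
  measurable_fun setT V -> (forall x, 0 <= V x) ->
  (forall B, measurable B ->
    (\int[m]_(x in V @^-1` B) (Phi x)%:E = c%:E * m (V @^-1` B))%E) ->
  0 <= c ->
  (\int[m]_x (Phi x * V x)%:E = c%:E * \int[m]_x (V x)%:E)%E.
Proof.
move=> mPhi Phi0 mV V0 PhiV c0.
(* [weighted_integral_comp] wants a nonnegative function on the whole line: the
   absolute value agrees with the identity on the values of [V]. *)
have mnorm : measurable_fun setT (fun y : R => `|y|) by exact: normr_measurable.
(* The image of [m] under [V] is a measure because [V] is measurable, so the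
   proof of measurability is an argument of [nu_of]. *)
pose nu_of : {measure set R -> \bar R} := pushforward m V.
pose nu := nu_of mV.
have nuE : (\int[nu]_y (`|y|)%:E = \int[m]_x (V x)%:E)%E.
  rewrite ge0_integral_pushforward//; last exact/measurable_EFinP.
  by rewrite preimage_setT; apply: eq_integral => x _ /=; rewrite ger0_norm.
rewrite -nuE -(weighted_integral_comp (m := m) mPhi Phi0 mV)//.
- by apply: eq_integral => x _; rewrite ger0_norm.
- by move=> B mB; rewrite (integral_mul_indic m (V @^-1` B)) PhiV.
Qed.

(** Replaces the indicators one by one, the weight absorbing those which have not
    been treated yet; [e i] is finite by assumption, so that the constant stays
    real. *)
Lemma weighted_integral_prod d d' (T : measurableType d) (U : measurableType d')
    (R : realType) (I : eqType) (m : {measure set T -> \bar R})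
    (Q : I -> probability U R) (V : I -> T -> U) (g : I -> U -> R) (e : I -> R)
    (J : seq I) (Phi : T -> R) (c : R) :
  (forall i, measurable_fun setT (V i)) ->
  (forall i, measurable_fun setT (g i)) -> (forall i y, 0 <= g i y) ->
  (forall i, (\int[Q i]_y (g i y)%:E = (e i)%:E)%E) ->
  uniq J ->
  measurable_fun setT Phi -> (forall x, 0 <= Phi x) -> 0 <= c ->
  (forall B : I -> set U, (forall i, measurable (B i)) ->
    (\int[m]_x (Phi x * \prod_(i <- J) \1_(B i) (V i x))%:E =
     (c * \prod_(i <- J) fine (Q i (B i)))%:E)%E) ->
  (\int[m]_x (Phi x * \prod_(i <- J) g i (V i x))%:E =
   (c * \prod_(i <- J) e i)%:E)%E.
Proof.
move=> mV mg g0 Qg; elim: J Phi c => [|i J IH] Phi c /=.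
  move=> _ mPhi Phi0 c0 /(_ (fun=> setT)); rewrite !big_nil => <-// .
  by under [RHS]eq_integral do rewrite big_nil; under eq_integral do rewrite big_nil.
move=> /andP[iJ uJ] mPhi Phi0 c0 PhiB.
have e0 k : 0 <= e k.
  by rewrite -lee_fin -Qg; apply: integral_ge0 => y _; rewrite lee_fin.
under eq_integral do rewrite big_cons mulrCA mulrC.
rewrite big_cons mulrCA mulrC EFinM -Qg.
apply: (weighted_integral_comp (m := m) (nu := Q i)) => //.
- apply: measurable_funM => //; apply: measurable_prod => k _.
  exact: measurableT_comp.
- by move=> x; rewrite mulr_ge0// prodr_ge0.
- move=> B mB; have QB : Q i B \is a fin_num by exact: fin_num_measure.
  under eq_integral do rewrite mulrAC.
  rewrite -[X in (_ * X)%E](fineK QB) -EFinM mulrAC; apply: IH => //.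
  + by apply: measurable_funM => //; exact: measurableT_comp.
  + by move=> x; rewrite mulr_ge0.
  + by rewrite mulr_ge0// fine_ge0.
  + move=> C mC.
    (* [i] is not in [J], so the sets for [J] and for [i] can be prescribed
       independently. *)
    have := PhiB (fun k => if k == i then B else C k).
    rewrite !big_cons eqxx.
    have neqi k : k \in J -> (k == i) = false.
      by move=> kJ; apply/negbTE; apply: contraNneq iJ => <-.
    rewrite (eq_big_seq (fun k => fine (Q k (C k)))); last first.
      by move=> k /neqi ->.
    rewrite mulrA => <-; last by move=> k; case: ifP.
    apply: eq_integral => x _; rewrite big_cons eqxx mulrA; congr (_ * _)%:E.
    by apply: eq_big_seq => k /neqi ->.
- by rewrite mulr_ge0// prodr_ge0.
Qed.

(** Independence replaces the indicator of an event of [U] by its probability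
    under the integral of any function of [V]; a second application of the same
    principle replaces the indicator by [U]. *)
Lemma independent_integral_mul d (T : measurableType d) (R : realType)
    (P : probability T R) (U V : T -> R) :
  measurable_fun setT U -> (forall x, 0 <= U x) ->
  measurable_fun setT V -> (forall x, 0 <= V x) ->
  (\int[P]_x (V x)%:E < +oo)%E ->
  independent_rv P U V ->
  (\int[P]_x (V x * U x)%:E = \int[P]_x (V x)%:E * \int[P]_x (U x)%:E)%E.
Proof.
move=> mU U0 mV V0 Voo UV.
have V0' : (0 <= \int[P]_x (V x)%:E)%E.
  by apply: integral_ge0 => x _; rewrite lee_fin.
have Vfin : (\int[P]_x (V x)%:E)%E \is a fin_num by rewrite ge0_fin_numE.
rewrite -(fineK Vfin); apply: weighted_integral_pushforward => //; last first.
  exact: fine_ge0.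
move=> A mA; rewrite fineK//.
have mUA : measurable (U @^-1` A) by rewrite -[X in measurable X]setTI; exact: mU.
have UAfin : P (U @^-1` A) \is a fin_num by exact: fin_num_measure.
rewrite -integral_mul_indic.
under eq_integral do rewrite mulrC.
rewrite muleC -[X in (X * _)%E](fineK UAfin).
apply: weighted_integral_pushforward => //; last first.
  exact: fine_ge0.
move=> B mB; rewrite fineK// -UV// integral_indic//.
by rewrite -[X in measurable X]setTI; exact: mV.
Qed.

(** * Gaussian exponential moments *)

Lemma integral_normal_prob (R : realType) (mu : R) (g : R -> R) :
  measurable_fun setT g -> (forall x, 0 <= g x) ->
  (\int[normal_prob mu 1]_x (g x)%:E =
   \int[lebesgue_measure]_x (normal_pdf mu 1 x * g x)%:E)%E.
Proof.
move=> mg g0.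
rewrite (@weighted_integral_comp _ _ _ _ _ lebesgue_measure (normal_prob mu 1) _ id 1)//.
- by rewrite mul1e.
- exact: measurable_normal_pdf.
- by move=> x; exact: normal_pdf_ge0.
- by move=> B mB; rewrite integral_mul_indic mul1e.
Qed.

(** Completing the square: tilting the N(mu,1) density by exp(alpha x) gives the
    N(mu + alpha,1) density times a constant. *)
Lemma normal_mgf (R : realType) (mu alpha : R) :
  (\int[normal_prob mu 1]_x (expR (alpha * x))%:E =
   (expR (alpha * mu + alpha ^+ 2 / 2))%:E)%E.
Proof.
rewrite integral_normal_prob; last 2 first.
- by apply: measurableT_comp => //; exact: measurable_funM.
- by move=> x; exact: expR_ge0.
have -> : (fun x => (normal_pdf mu 1 x * expR (alpha * x))%:E) =
    (fun x => ((expR (alpha * mu + alpha ^+ 2 / 2))%:E *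
               (normal_pdf (mu + alpha) 1 x)%:E))%E.
  apply/funext => x; rewrite -EFinM; congr EFin.
  rewrite !normal_pdfE ?oner_eq0// /normal_fun -[LHS]mulrA [RHS]mulrCA -!expRD.
  by congr (_ * expR _); field.
rewrite integralZl//; last exact: integrable_normal_pdf.
by rewrite integral_normal_pdf mule1.
Qed.

(** * Optional stopping *)

Lemma measurable_wrt_measurable d (T : measurableType d) (R : realType)
    (G : set (set T)) (f : T -> R) :
  G `<=` measurable -> measurable_wrt G f -> measurable_fun setT f.
Proof. by move=> GT Gf _ B mB; rewrite setTI; apply: GT; exact: Gf. Qed.

(** The version [Y] of the conditional expectation may be negative on a null
    set; its positive part still lies below [M t] almost everywhere. *)
Lemma supermartingale_integral_le d (T : measurableType d) (R : realType)
    (P : probability T R) (F : nat -> set (set T)) (M : nat -> T -> R) t A :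
  F t `<=` measurable -> (forall w, 0 <= M t w) ->
  supermartingale P F M -> F t A ->
  (\int[P]_(w in A) (M t.+1 w)%:E <= \int[P]_(w in A) (M t w)%:E)%E.
Proof.
move=> Fm M0 [adF _ /(_ t)[Y [FY iY condY] YM]] FA; have mA := Fm _ FA.
have mY : measurable_fun A (EFin \o Y).
  exact: measurable_funS (measurable_int _ iY).
have mM : measurable_fun A (EFin \o M t).
  apply/measurable_funTS/measurable_EFinP.
  exact: measurable_wrt_measurable Fm (adF t).
rewrite -condY// integralE.
apply: (@le_trans _ _ (\int[P]_(w in A) (EFin \o Y)^\+ w)%E).
  by rewrite geeDl// oppe_le0; apply: integral_ge0.
apply: ae_ge0_le_integral => //.
- exact: measurable_funepos.
- by move=> w _; rewrite lee_fin.
- apply: filterS YM => w YMw _.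
  by rewrite funeposE ge_max !lee_fin YMw M0.
Qed.

Section optional_stopping.
Context (R : realType) (d : measure_display) (T : measurableType d)
  (P : probability T R) (F : nat -> set (set T)) (M : nat -> T -> R)
  (tau : T -> option nat).
Context (Fsigma : forall t, sigma_algebra setT (F t))
  (Fm : forall t, F t `<=` measurable) (M0 : forall t w, 0 <= M t w)
  (superM : supermartingale P F M) (stopF : stopping_time F tau).

Let hit t : set T := [set w | tau w = Some t].
Let alive t : set T := [set w | forall s, tau w = Some s -> (t <= s)%N].

(** The event [t < tau], infinite values included, is the complement of the event
    that the definition of a stopping time puts in [F t]. *)
Let F_aliveS t : F t (alive t.+1).
Proof.
have [_ FC _] := Fsigma t; have := FC _ (stopF t).
congr (F t _); apply/seteqP; split => w /=.
  by move=> [_ Nle] s ws; rewrite ltnNge; apply/negP => st; apply: Nle; exists s.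
by move=> al; split=> // -[s ws]; rewrite leqNgt (al s ws).
Qed.

Let measurable_alive t : measurable (alive t).
Proof.
case: t => [|t]; last exact: Fm (F_aliveS t).
by rewrite (_ : alive 0 = setT)//; apply/seteqP; split.
Qed.

Let alive_recl t : alive t = hit t `|` alive t.+1.
Proof.
apply/seteqP; split => w /=.
  case E : (tau w) => [s|] al; last by right => s; rewrite E.
  have := al s E; rewrite leq_eqVlt => /predU1P[->|ts]; first by left.
  by right => s'; rewrite E => -[<-].
move=> [ws s|al s ws]; last by apply: ltnW; exact: al.
by rewrite ws => -[->].
Qed.

Let hit_alive_disjoint t : hit t `&` alive t.+1 = set0.
Proof. by apply/seteqP; split => // w [ws /(_ _ ws)]; rewrite /= ltnn. Qed.

Let measurable_hit t : measurable (hit t).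
Proof.
rewrite (_ : hit t = alive t `\` alive t.+1); first exact: measurableD.
rewrite alive_recl setDUl setDv setU0; apply/esym/setDidl.
exact: hit_alive_disjoint.
Qed.

Let measurable_M t : measurable_fun setT (M t).
Proof. by case: superM => adF _ _; exact: measurable_wrt_measurable (@Fm t) (adF t). Qed.

(** The left-hand side is the mean of the process stopped at time [n] or at
    [tau], whichever comes first; it decreases in [n]. *)
Let stopped_sum_le n :
  (\sum_(0 <= t < n) \int[P]_(w in hit t) (M t w)%:E +
   \int[P]_(w in alive n) (M n w)%:E <= \int[P]_w (M 0%N w)%:E)%E.
Proof.
elim: n => [|n IH].
  by rewrite big_geq// add0e (_ : alive 0 = setT)//; apply/seteqP; split.
apply: le_trans IH; rewrite big_nat_recr//= -addeA; apply: leeD2l; rewrite (alive_recl n).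
rewrite ge0_integral_setU//; last 3 first.
- exact/measurable_EFinP/measurable_funTS.
- by move=> w _; rewrite lee_fin.
- by apply/disj_setPS; rewrite hit_alive_disjoint.
by apply: leeD2l; exact: supermartingale_integral_le.
Qed.

(** Since [stopped] vanishes where [tau] is infinite, its mean is the sum over [t]
    of the means over [tau = t]; [stopped_sum_le] bounds the partial sums. *)
Lemma optional_stopping : ('E_P[stopped M tau] <= 'E_P[M 0%N])%E.
Proof.
rewrite unlock.
have stoppedE t w : hit t w -> stopped M tau w = M t w by rewrite /stopped => ->.
have -> : (\int[P]_w (stopped M tau w)%:E =
    \int[P]_(w in \bigcup_t hit t) (stopped M tau w)%:E)%E.
  rewrite [RHS]integral_mkcond; apply: eq_integral => w _.
  rewrite patchE; case: ifPn => //; rewrite notin_setE => Nhit.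
  rewrite /stopped; case E : (tau w) => [t|//].
  by exfalso; apply: Nhit; exists t.
rewrite ge0_integral_bigcup//; last 3 first.
- apply/measurable_fun_bigcup => // t.
  apply: (@eq_measurable_fun _ _ _ _ _ (EFin \o M t)).
    by move=> w; rewrite inE => /stoppedE /= ->.
  exact/measurable_EFinP/measurable_funTS.
- by move=> w [t _ /stoppedE ->]; rewrite lee_fin.
- apply/trivIsetP => s t _ _ /eqP st; apply/seteqP; split => // w [ws wt].
  by apply: st; move: wt; rewrite /hit/= ws => -[].
apply: lime_le.
  apply: is_cvg_nneseries => t _ _; apply: integral_ge0 => w /stoppedE ->.
  by rewrite lee_fin.
apply: nearW => n.
apply: le_trans (stopped_sum_le n).
rewrite (eq_bigr (fun t => \int[P]_(w in hit t) (M t w)%:E)%E).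
  by rewrite leeDl// integral_ge0// => w _; rewrite lee_fin.
by move=> t _; apply: eq_integral => w; rewrite inE => /stoppedE ->.
Qed.

End optional_stopping.

Lemma mean_test_supermartingale_e_process d (T : measurableType d) (R : realType)
    (F : nat -> set (set T)) (H : set (probability T R)) (M : nat -> T -> R) :
  (forall t, sigma_algebra setT (F t)) -> (forall t, F t `<=` measurable) ->
  mean_test_supermartingale F H M -> e_process F H M.
Proof.
move=> Fsigma Fm [M0 adM superM M01]; split => // P tau HP stop _.
exact: le_trans (optional_stopping Fsigma Fm M0 (superM P HP) stop) (M01 P HP).
Qed.

(** * The shared-control model *)

Lemma indic_forall_seq (T : Type) (R : pzRingType) (I : eqType) (J : seq I)
    (S : I -> set T) (x : T) :
  \1_[set w | forall i, i \in J -> S i w] x = \prod_(i <- J) \1_(S i) x :> R.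
Proof.
elim: J => [|i J IH].
  by rewrite big_nil indicE mem_set.
rewrite big_cons -IH.
transitivity (\1_(S i `&` [set w | forall k, k \in J -> S k w]) x : R); last first.
  by rewrite indicI.
congr (\1_ _ x); apply/seteqP; split => w /=.
  by move=> h; split=> [|k kJ]; apply: h; rewrite inE ?eqxx ?kJ ?orbT.
by move=> [Si SJ] k; rewrite inE => /predU1P[->|/SJ].
Qed.

(** Lets the closure properties of measurable functions apply to functions that
    are measurable with respect to a generated system of sets. *)
Lemma measurable_wrt_generated d (T : measurableType d) (R : realType)
    (G : set (set T)) (f : T -> R) :
  measurable_wrt <<s G>> f <->
  measurable_fun setT (f : g_sigma_algebraType G -> R).
Proof.
split=> [Gf _ B mB|mf B mB]; first by rewrite setTI; exact: Gf.
by rewrite -[X in <<s G>> X]setTI; exact: mf.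
Qed.

Section shared_control.
Context (R : realType) (d : measure_display) (T : measurableType d)
  (d' : measure_display) (S : measurableType d') (I : choiceType).
Context (a : I -> nat) (C : nat -> {mfun T >-> R})
  (X : I -> nat -> {mfun T >-> R}) (D : nat -> {mfun T >-> S}).
Context (lambda : I -> R).

Local Notation hist := (history a C X D).

Lemma history_measurable n : hist n `<=` measurable.
Proof.
apply: smallest_sub; first exact: sigma_algebra_measurable.
by move=> E [s _ [|[i _]|]] [B mB <-]; exact: measurable_funP.
Qed.

Lemma history_sigma_algebra n : sigma_algebra setT (hist n).
Proof. exact: smallest_sigma_algebra. Qed.

Lemma history_control n s : (s < n)%N -> measurable_wrt (hist n) (C s).
Proof.
move=> sn B mB; apply: sub_gen_smallest; exists s => //; constructor 1.
by exists B => //; rewrite setTI.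
Qed.

Lemma history_arm n s i : (a i <= s < n)%N -> measurable_wrt (hist n) (X i s).
Proof.
move=> /andP[ais sn] B mB; apply: sub_gen_smallest; exists s => //; constructor 2.
by exists i => //; exists B => //; rewrite setTI.
Qed.

Definition arm_factor (i : I) (u : nat) (w : T) : R :=
  expR (lambda i * comparison C X i u w - lambda i ^+ 2 / 2).

(** The arm process just before update [n]; indexing by the number of updates
    makes the empty product available at [n = 0], also for arms which are active
    from the start. *)
Definition arm_product (i : I) (n : nat) (w : T) : R :=
  \prod_(a i <= u < n) arm_factor i u w.

Lemma arm_processE i t : arm_process a C X lambda i t = arm_product i t.+1.
Proof.
apply/funext => w; rewrite /arm_process /arm_product; case: leqP => // ta.
by rewrite big_geq.
Qed.

Lemma history_arm_product i n : measurable_wrt (hist n) (arm_product i n).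
Proof.
apply/measurable_wrt_generated; apply: measurable_prod => u.
rewrite mem_index_iota => aun; apply: measurableT_comp => //.
apply: measurable_funB => //; apply: measurable_funM => //.
apply: measurable_funM => //; apply: measurable_funB.
  by apply: (measurable_wrt_generated _ _).1; exact: history_arm.
by apply: (measurable_wrt_generated _ _).1; apply: history_control; case/andP: aun.
Qed.

Definition arm_products (J : seq I) (n : nat) (w : T) : R :=
  \prod_(i <- J) arm_product i n w.

Lemma arm_products_ge0 J n w : 0 <= arm_products J n w.
Proof. by apply: prodr_ge0 => i _; apply: prodr_ge0 => u _; exact: expR_ge0. Qed.

Lemma history_arm_products J n : measurable_wrt (hist n) (arm_products J n).
Proof.
apply/measurable_wrt_generated; apply: measurable_prod => i _.
by apply: (measurable_wrt_generated _ _).1; exact: history_arm_product.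
Qed.

Lemma arm_productsS J n w : arm_products J n.+1 w =
  arm_products J n w * \prod_(i <- J | (a i <= n)%N) arm_factor i n w.
Proof.
rewrite /arm_products [X in _ = _ * X]big_mkcond -[RHS]big_split/=.
apply: eq_bigr => i _; rewrite /arm_product.
by case: leqP => an; [rewrite big_nat_recr | rewrite !big_geq ?mulr1// ltnW].
Qed.

Lemma arm_product1 i n : arm_product i n = arm_products [:: i] n.
Proof. by apply/funext => w; rewrite /arm_products big_seq1. Qed.

Lemma measurable_arm_products J n : measurable_fun setT (arm_products J n).
Proof.
exact: measurable_wrt_measurable (@history_measurable n) (@history_arm_products J n).
Qed.

Lemma arm_process_ge0 i t w : 0 <= arm_process a C X lambda i t w.
Proof. by rewrite arm_processE arm_product1 arm_products_ge0. Qed.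

Section under_model.
Context (mu : I -> R) (P : probability T R).
Context (model : shared_control_model a C X D mu P).

Let outcome (k : option I) (t : nat) : {mfun T >-> R} :=
  if k is Some i then X i t else C t.

Let law (k : option I) : probability (measurableTypeR R) R :=
  normal_prob (if k is Some i then mu i else 0) 1.

Let slots (J : seq I) : seq (option I) := None :: map some J.

(** The slot [None] stands for the control, [Some i] for arm [i]: after
    multiplying by the indicator of a past event, the outcomes of an update are
    independent. *)
Lemma model_joint_law t (J : seq I) G (B : option I -> set R) :
  uniq J -> (forall i, i \in J -> (a i <= t)%N) -> hist t G ->
  (forall k, measurable (B k)) ->
  (\int[P]_x (\1_G x * \prod_(k <- slots J) \1_(B k) (outcome k t x))%:E =
   (fine (P G) * \prod_(k <- slots J) fine (law k (B k)))%:E)%E.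
Proof.
move=> uJ Ja FG mB.
have mG : measurable G by exact: history_measurable FG.
have [_ _ /(_ _ FG) cE] := model uJ Ja (mB None) (fun i => mB (Some i)).
have {}cE := etrans (esym (integral_cst P mG _%:E)) cE.
under eq_integral do rewrite mulrC.
rewrite integral_mul_indic big_cons big_map/= mulrC EFinM fineK ?fin_num_measure//.
rewrite [RHS]cE; apply: eq_integral => x _; congr EFin.
by rewrite indicI/= big_cons big_map/= indic_forall_seq.
Qed.

(** The exponential of a combination of comparisons splits into one factor for
    the control, with loading -(sum_i theta_i)/sqrt 2, and one factor for each
    arm, with loading theta_i/sqrt 2; the right-hand side collects their moment
    generating functions. *)
Lemma integral_history_exp_comparisons t (J : seq I) (theta : I -> R) (W : T -> R) :
  uniq J -> (forall i, i \in J -> (a i <= t)%N) ->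
  measurable_wrt (hist t) W -> (forall x, 0 <= W x) ->
  (\int[P]_x (W x * expR (\sum_(i <- J) theta i * comparison C X i t x))%:E =
   (expR (\sum_(i <- J) theta i * mu i / Num.sqrt 2 +
      (\sum_(i <- J) theta i ^+ 2 + (\sum_(i <- J) theta i) ^+ 2) / 4))%:E *
   \int[P]_x (W x)%:E)%E.
Proof.
move=> uJ Ja FW W0.
pose s2 : R := Num.sqrt 2.
have s20 : s2 != 0 by rewrite gt_eqF// sqrtr_gt0.
have s2s2 : s2 ^+ 2 = 2 by rewrite sqr_sqrtr.
pose alpha (k : option I) : R :=
  if k is Some i then theta i / s2 else - (\sum_(i <- J) theta i) / s2.
pose g k (y : R) := expR (alpha k * y).
have mg k : measurable_fun setT (g k).
  by apply: measurableT_comp => //; exact: measurable_funM.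
pose e k := expR (alpha k * (if k is Some i then mu i else 0) + alpha k ^+ 2 / 2).
have expE x : expR (\sum_(i <- J) theta i * comparison C X i t x) =
    \prod_(k <- slots J) g k (outcome k t x).
  rewrite -expR_sum; congr expR; rewrite big_cons big_map/=.
  rewrite mulrAC mulNr mulNr addrC mulr_suml mulr_suml -sumrB.
  by apply: eq_bigr => i _; rewrite /comparison -/s2; field.
have uS : uniq (slots J).
  rewrite /= map_inj_uniq ?uJ ?andbT; last by move=> i j [].
  by apply/mapP => -[].
have mW : measurable_fun setT W.
  exact: measurable_wrt_measurable (@history_measurable t) FW.
have eE : expR (\sum_(i <- J) theta i * mu i / Num.sqrt 2 +
      (\sum_(i <- J) theta i ^+ 2 + (\sum_(i <- J) theta i) ^+ 2) / 4) =
    \prod_(k <- slots J) e k.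
  rewrite -expR_sum big_cons big_map/=; congr expR.
  rewrite big_split/= mulr0 add0r addrCA; congr (_ + _).
    by apply: eq_bigr => i _; rewrite -/s2 mulrAC.
  rewrite addrC mulrDl exprMn sqrrN exprVn s2s2; congr (_ + _); last by field.
  rewrite mulr_suml; apply: eq_bigr => i _; rewrite exprMn exprVn s2s2.
  by field.
under eq_integral do rewrite mulrC expE.
rewrite eE; apply: weighted_integral_pushforward => //.
- by apply: measurable_prod => k _; exact: measurableT_comp.
- by move=> x; apply: prodr_ge0 => k _; exact: expR_ge0.
- move=> B mB.
  rewrite -integral_mul_indic; under eq_integral do rewrite mulrC.
  have FG : hist t (W @^-1` B) by exact: FW.
  have mG : measurable (W @^-1` B) by exact: history_measurable FG.
  rewrite (weighted_integral_prod (Q := law) (e := e) (c := fine (P (W @^-1` B))))//.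
  + by rewrite mulrC EFinM fineK// fin_num_measure.
  + by move=> k; exact: (measurable_funPT (outcome k t)).
  + by move=> k y; exact: expR_ge0.
  + by move=> k; exact: normal_mgf.
  + exact: fine_ge0.
  + by move=> B' mB'; exact: model_joint_law.
- by apply: prodr_ge0 => k _; exact: expR_ge0.
Qed.

(** The second summand is (Var(S) - sum_i lambda_i^2)/2 for the combination
    S = sum_i lambda_i Z_i of active comparisons, i.e. the sum over the pairs of
    distinct active arms of half the product of their lambdas. *)
Let log_growth (J : seq I) (t : nat) : R :=
  \sum_(i <- J | (a i <= t)%N) lambda i * mu i / Num.sqrt 2 +
  ((\sum_(i <- J | (a i <= t)%N) lambda i) ^+ 2 -
   \sum_(i <- J | (a i <= t)%N) lambda i ^+ 2) / 4.

Lemma integral_history_arm_factors t (J : seq I) (W : T -> R) :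
  uniq J -> measurable_wrt (hist t) W -> (forall x, 0 <= W x) ->
  (\int[P]_x (W x * \prod_(i <- J | (a i <= t)%N) arm_factor i t x)%:E =
   (expR (log_growth J t))%:E * \int[P]_x (W x)%:E)%E.
Proof.
move=> uJ FW W0.
pose J' := [seq i <- J | (a i <= t)%N].
pose k := expR (- \sum_(i <- J') lambda i ^+ 2 / 2).
have mW : measurable_fun setT W.
  exact: measurable_wrt_measurable (@history_measurable t) FW.
have FkW : measurable_wrt (hist t) (fun x => k * W x).
  apply: (measurable_wrt_generated _ _).2; apply: measurable_funM => //.
  exact: (measurable_wrt_generated _ _).1.
transitivity (\int[P]_x ((k * W x) *
    expR (\sum_(i <- J') lambda i * comparison C X i t x))%:E)%E.
  apply: eq_integral => x _; congr EFin.
  rewrite mulrAC mulrC; congr (_ * _).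
  by rewrite -big_filter -expR_sum sumrB expRD mulrC.
rewrite integral_history_exp_comparisons//; last 3 first.
- by rewrite filter_uniq.
- by move=> i; rewrite mem_filter => /andP[].
- by move=> x; rewrite mulr_ge0// expR_ge0.
under eq_integral do rewrite EFinM.
rewrite ge0_integralZl//; last 3 first.
- exact/measurable_EFinP.
- by move=> x _; rewrite lee_fin.
- by rewrite lee_fin expR_ge0.
rewrite muleA -EFinM -expRD; congr ((expR _)%:E * _)%E.
have -> : \sum_(i <- J') lambda i ^+ 2 / 2 = (\sum_(i <- J') lambda i ^+ 2) / 2.
  by rewrite mulr_suml.
rewrite /log_growth -!(big_filter J) -/J'.
move: (\sum_(i <- J') lambda i * mu i / Num.sqrt 2) => p.
move: (\sum_(i <- J') lambda i ^+ 2) (\sum_(i <- J') lambda i) => q s.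
by field.
Qed.

Lemma integral_arm_products (J : seq I) n : uniq J ->
  (\int[P]_x (arm_products J n x)%:E =
   (expR (\sum_(0 <= u < n) log_growth J u))%:E)%E.
Proof.
move=> uJ; elim: n => [|n IH].
  rewrite big_geq// expR0.
  transitivity (\int[P]_x (cst 1%E x))%E; last first.
    by rewrite integral_cst// mul1e; exact: probability_setT.
  apply: eq_integral => x _; rewrite /arm_products big1// => i _.
  by rewrite /arm_product big_geq.
under eq_integral do rewrite arm_productsS.
rewrite integral_history_arm_factors//; last 2 first.
- exact: history_arm_products.
- exact: arm_products_ge0.
by rewrite IH -EFinM -expRD big_nat_recr// addrC.
Qed.

Lemma integrable_arm_products (J : seq I) n : uniq J ->
  P.-integrable setT (EFin \o arm_products J n).
Proof.
move=> uJ; apply/integrableP; split.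
  exact/measurable_EFinP/measurable_arm_products.
under eq_integral do rewrite /= ger0_norm ?arm_products_ge0//.
by rewrite integral_arm_products// ltry.
Qed.

Lemma log_growth1 i t :
  log_growth [:: i] t = if (a i <= t)%N then lambda i * mu i / Num.sqrt 2 else 0.
Proof.
rewrite /log_growth !big_cons !big_nil; case: ifP => _; last by field.
by rewrite !addr0 subrr mul0r addr0.
Qed.

Lemma log_growth2 i j t :
  log_growth [:: i; j] t = log_growth [:: i] t + log_growth [:: j] t +
  (if (a i <= t)%N && (a j <= t)%N then lambda i * lambda j / 2 else 0).
Proof.
rewrite !log_growth1 /log_growth !big_cons !big_nil.
by case: (a i <= t)%N; case: (a j <= t)%N => /=; field.
Qed.

Context (lambda_gt0 : forall i, 0 < lambda i).

Lemma log_growth1_le0 i t : mu i <= 0 -> log_growth [:: i] t <= 0.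
Proof.
move=> mu0; rewrite log_growth1; case: ifP => // _.
by rewrite mulr_le0_ge0 ?invr_ge0 ?sqrtr_ge0// mulr_ge0_le0// ltW.
Qed.

Lemma expectation_arm_process_le1 i t : mu i <= 0 ->
  ('E_P[arm_process a C X lambda i t] <= 1)%E.
Proof.
move=> mu0; rewrite unlock arm_processE arm_product1 integral_arm_products//.
rewrite lee_fin -expR0 ler_expR; apply: sumr_le0 => u _; exact: log_growth1_le0.
Qed.

Lemma supermartingale_arm_process i : mu i <= 0 ->
  supermartingale P (global_filtration a C X D) (arm_process a C X lambda i).
Proof.
move=> mu0; split.
- by move=> t; rewrite arm_processE; exact: history_arm_product.
- by move=> t; rewrite arm_processE arm_product1; exact: integrable_arm_products.
move=> t; rewrite !arm_processE !arm_product1 /global_filtration.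
set M := arm_products [:: i] t.+1.
exists (fun w => expR (log_growth [:: i] t.+1) * M w); last first.
  apply: aeW => w /=; rewrite ler_piMl ?arm_products_ge0//.
  by rewrite -expR0 ler_expR log_growth1_le0.
have FM : measurable_wrt (hist t.+1) M by exact: history_arm_products.
split.
- apply: (measurable_wrt_generated _ _).2; apply: measurable_funM => //.
  exact: (measurable_wrt_generated _ _).1.
- have := integrableZl measurableT (expR (log_growth [:: i] t.+1))
    (@integrable_arm_products [:: i] t.+1 isT).
  by apply: eq_integrable => // w _; rewrite /= EFinM.
move=> A FA; have mA := history_measurable FA.
have F1 : measurable_wrt (hist t.+1) (fun w => M w * \1_A w).
  apply: (measurable_wrt_generated _ _).2; apply: measurable_funM.
    exact: (measurable_wrt_generated _ _).1.
  exact: measurable_indic.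
rewrite -[RHS]integral_mul_indic.
under [RHS]eq_integral do rewrite arm_productsS mulrAC.
rewrite integral_history_arm_factors//; last first.
  by move=> w; rewrite mulr_ge0// arm_products_ge0.
rewrite integral_mul_indic; under [LHS]eq_integral do rewrite /= EFinM.
rewrite ge0_integralZl//.
- exact/measurable_EFinP/measurable_funTS/measurable_arm_products.
- by move=> x _; rewrite lee_fin arm_products_ge0.
Qed.

(** At every update the log growth of the pair is at least the sum of the two log
    growths, and strictly larger at update [t], where both arms are active. *)
Lemma integral_arm_process_mul_gt i j t :
  i != j -> (a i <= t)%N -> (a j <= t)%N ->
  (\int[P]_x (arm_process a C X lambda i t x)%:E *
   \int[P]_x (arm_process a C X lambda j t x)%:E <
   \int[P]_x (arm_process a C X lambda i t x * arm_process a C X lambda j t x)%:E)%E.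
Proof.
move=> ij ait ajt; rewrite !arm_processE.
have -> : (fun x => (arm_product i t.+1 x * arm_product j t.+1 x)%:E) =
    EFin \o arm_products [:: i; j] t.+1.
  by apply/funext => x; rewrite /= /arm_products !big_cons big_nil mulr1.
have uij : uniq [:: i; j] by rewrite /= inE ij.
rewrite !arm_product1 !integral_arm_products//.
rewrite -EFinM -expRD lte_fin ltr_expR -big_split/= !big_nat_recr//=.
have ll : 0 < lambda i * lambda j / 2 by rewrite divr_gt0// mulr_gt0.
rewrite ler_ltD//; last by rewrite log_growth2 ait ajt/= ltrDl.
apply: ler_sum => u _; rewrite log_growth2 lerDl.
by case: ifP => // _; exact: ltW.
Qed.

Lemma measurable_arm_process i t :
  measurable_fun setT (arm_process a C X lambda i t).
Proof. by rewrite arm_processE arm_product1; exact: measurable_arm_products. Qed.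

Lemma integrable_arm_process i t :
  P.-integrable setT (EFin \o arm_process a C X lambda i t).
Proof. by rewrite arm_processE arm_product1; exact: integrable_arm_products. Qed.

Lemma arm_process_not_independent i j t :
  i != j -> (a i <= t)%N -> (a j <= t)%N ->
  ~ independent_rv P (arm_process a C X lambda i t) (arm_process a C X lambda j t).
Proof.
move=> ij ait ajt indep.
have := integral_arm_process_mul_gt ij ait ajt; rewrite ltNge => /negP; apply.
rewrite muleC -independent_integral_mul//.
- by under eq_integral do rewrite mulrC.
- exact: measurable_arm_process.
- by move=> x; exact: arm_process_ge0.
- exact: measurable_arm_process.
- by move=> x; exact: arm_process_ge0.
- by rewrite arm_processE arm_product1 integral_arm_products// ltry.
Qed.

Lemma arm_process_covariance_gt0 i j t :
  i != j -> (a i <= t)%N -> (a j <= t)%N ->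
  (0 < covariance P (arm_process a C X lambda i t) (arm_process a C X lambda j t))%E.
Proof.
move=> ij ait ajt; rewrite covarianceE; last 3 first.
- exact/Lfun1_integrable/integrable_arm_process.
- exact/Lfun1_integrable/integrable_arm_process.
- apply/Lfun1_integrable.
  rewrite (_ : EFin \o _ = EFin \o arm_products [:: i; j] t.+1).
    by apply: integrable_arm_products; rewrite /= inE ij.
  apply/funext => w; rewrite /= !arm_processE mulrfctE/=.
  by rewrite /arm_products !big_cons big_nil mulr1.
have := integral_arm_process_mul_gt ij ait ajt.
by rewrite -sube_gt0 unlock.
Qed.

End under_model.
End shared_control.

(** * E-process property and dependence of the arm processes *)

Theorem proposition5p1 (R : realType)
    (d : measure_display) (T : measurableType d)
    (d' : measure_display) (S : measurableType d')
    (I : choiceType) (a : I -> nat)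
    (C : nat -> {mfun T >-> R}) (X : I -> nat -> {mfun T >-> R})
    (D : nat -> {mfun T >-> S})
    (lambda : I -> R) (lambda_gt0 : forall i, 0 < lambda i) :
  let F := global_filtration a C X D in
  let H := null_hypothesis a C X D in
  let M := arm_process a C X lambda in
  (forall i, [/\ (0 < a i)%N -> test_supermartingale F (H i) (M i),
                 mean_test_supermartingale F (H i) (M i) &
                 e_process F (H i) (M i)])
  /\
  (forall (mu : I -> R) (P : probability T R) (i j : I) (t : nat),
     shared_control_model a C X D mu P ->
     i != j -> (a i <= t)%N -> (a j <= t)%N ->
     ~ independent_rv P (M i t) (M j t) /\
     (0 < covariance P (M i t) (M j t))%E).
Proof.
move=> F H M; split=> [i|mu P i j t model ij ait ajt]; last first.
  split; first exact: (arm_process_not_independent model).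
  exact: (arm_process_covariance_gt0 model).
have M0 t w : 0 <= M i t w by exact: arm_process_ge0.
have adM : adapted F (M i).
  by move=> t; rewrite /M arm_processE; exact: history_arm_product.
have superM P : H i P -> supermartingale P F (M i).
  by move=> [mu model mu0]; exact: supermartingale_arm_process model _ _ mu0.
have mtest : mean_test_supermartingale F (H i) (M i).
  split=> // P [mu model mu0].
  exact: expectation_arm_process_le1 model _ _ _ mu0.
split=> //.
  by move=> ai_gt0; split=> // w; rewrite /M /arm_process leqNgt ai_gt0.
apply: mean_test_supermartingale_e_process => // t.
  exact: history_sigma_algebra.
exact: history_measurable.
Qed.
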